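(* Let $\mathcal{P}_3^{\mathrm{crit}}$ be the moduli space of polynomials of degree $3$ with marked critical points, i.e., points of $\mathcal{P}_3^{\mathrm{crit}}$ are equivalence classes of triples $(f,c_1,c_2)$, where $f\in\mathbb{C}[z]$ is a polynomial of degree $3$ and $c_1$ and $c_2$ are the critical points of $f$. For integers $n,m\ge 1$, let $$C_{1,n}=\{(f,c_1,c_2)\in\mathcal{P}_3^{\mathrm{crit}} : c_1 \text{ is periodic with } f^n(c_1)=c_1\},$$ $$C_{2,m}=\{(f,c_1,c_2)\in\mathcal{P}_3^{\mathrm{crit}} : c_2 \text{ is periodic with } f^m(c_2)=c_2\}.$$ Then $C_{1,n}$ and $C_{2,m}$ intersect transversally at all of their points of intersection.
   Context: Here $f^n$ denotes the $n$-th iterate of $f$ under composition. The critical points are counted with multiplicity, so $c_1=c_2$ is allowed (when $f'$ has a double root). Two triples are equivalent if they are conjugate by an affine change of variable $z\mapsto \alpha z+\beta$ with $\alpha\neq 0$ (acting on $f$ by conjugation and correspondingly on the marked critical points). Meaning of transversality: after an affine change of variables every triple may be put in the form $(f_{x,y},x,-x)$ with $f_{x,y}(z)=z^3-3x^2z+y$, $(x,y)\in\mathbb{C}^2$, and transversality is understood in these coordinates $(x,y)$. In these coordinates $C_{1,n}$ and $C_{2,m}$ are the plane curves $F^{(n)}(x,y)=0$ and $G^{(m)}(x,y)=0$, where $$F^{(n)}(x,y)=f_{x,y}^n(x)-x,\qquad G^{(m)}(x,y)=f_{x,y}^m(-x)+x .$$ The curves are transversal at a common point $(\alpha,\beta)\in\mathbb{C}^2$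 (a point with $F^{(n)}(\alpha,\beta)=G^{(m)}(\alpha,\beta)=0$) if and only if the Jacobian determinant does not vanish there: $$\det\begin{pmatrix} \partial F^{(n)}/\partial x & \partial G^{(m)}/\partial x\\ \partial F^{(n)}/\partial y & \partial G^{(m)}/\partial y\end{pmatrix}(\alpha,\beta)\neq 0 .$$ *)

(* Defs.v *)
(* The field of complex numbers is R[i] with R : realType. *)
From mathcomp Require Import all_boot all_order all_algebra.
From mathcomp Require Import boolp classical_sets reals.
From mathcomp Require Export complex.
From mathcomp Require Import mpoly.

Set Implicit Arguments.
Unset Strict Implicit.
Unset Printing Implicit Defensive.

Import Order.TTheory GRing.Theory Num.Theory.
Local Open Scope ring_scope.
Local Open Scope classical_set_scope.

(* [mc_crit] says that (c1, c2) lists the roots of f' with multiplicity: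
   %= is equality up to a nonzero constant factor. *)
Record marked_cubic (K : fieldType) := MarkedCubic {
  mc_poly : {poly K};
  mc_c1 : K;
  mc_c2 : K;
  mc_size : size mc_poly = 4%N;
  mc_crit : mc_poly^`() %= ('X - mc_c1%:P) * ('X - mc_c2%:P) }.

(* For A(z) = a z + b, the first equation reads g o A = A o f,
   that is, g = A o f o A^-1. *)
Definition affine_conj (K : fieldType) (t u : marked_cubic K) : Prop :=
  exists a b : K, a != 0 /\
    let A := a *: 'X + b%:P in
    [/\ mc_poly u \Po A = A \Po mc_poly t,
        mc_c1 u = A.[mc_c1 t] &
        mc_c2 u = A.[mc_c2 t]].

(* A point of the moduli space is an equivalence class, represented as the set
   of its members. *)
Record P3crit (K : fieldType) := P3Crit {
  P3crit_class : set (marked_cubic K);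
  P3crit_classP : exists t, P3crit_class = [set u | affine_conj t u] }.

Definition C1 {K : fieldType} (n : nat) : set (P3crit K) :=
  [set P | exists2 t, P3crit_class P t &
           iter n (horner (mc_poly t)) (mc_c1 t) = mc_c1 t].

Definition C2 {K : fieldType} (m : nat) : set (P3crit K) :=
  [set P | exists2 t, P3crit_class P t &
           iter m (horner (mc_poly t)) (mc_c2 t) = mc_c2 t].

(* Used both for x, y complex numbers and for x, y the two indeterminates. *)
Definition cubic_nf (A : comNzRingType) (x y : A) : {poly A} :=
  'X^3 - (3%:R * x ^+ 2) *: 'X + y%:P.

Lemma size_cubic_nf (A : comNzRingType) (x y : A) : size (cubic_nf x y) = 4%N.
Proof.
rewrite /cubic_nf -addrA size_polyDl size_polyXn //.
apply: (leq_ltn_trans (size_polyD _ _)); rewrite gtn_max size_polyN.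
rewrite (leq_ltn_trans (size_scale_leq _ _)) ?size_polyX //.
by rewrite (leq_ltn_trans (size_polyC_leq1 _)).
Qed.

Lemma cubic_nf_crit (K : numFieldType) (x y : K) :
  (cubic_nf x y)^`() %= ('X - x%:P) * ('X - (- x)%:P).
Proof.
have -> : (cubic_nf x y)^`() = 3%:R *: (('X - x%:P) * ('X - (- x)%:P)).
  rewrite /cubic_nf derivD derivB derivXn derivZ derivX derivC addr0 /=.
  rewrite polyCN opprK mulrC -subr_sqr -polyC_exp scalerBr scaler_nat.
  by rewrite -mul_polyC mulr1 -mul_polyC -polyCM [x ^+ 2 * _]mulrC.
by rewrite eqp_scale // pnatr_eq0.
Qed.

Definition marked_nf (K : numFieldType) (x y : K) : marked_cubic K :=
  MarkedCubic (size_cubic_nf x y) (cubic_nf_crit x y).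

(* F^(n) and G^(m), with x = 'X_0 and y = 'X_1. *)
Definition Fpoly (K : fieldType) (n : nat) : {mpoly K[2]} :=
  let x : {mpoly K[2]} := 'X_0 in let y : {mpoly K[2]} := 'X_1 in
  iter n (horner (cubic_nf x y)) x - x.

Definition Gpoly (K : fieldType) (m : nat) : {mpoly K[2]} :=
  let x : {mpoly K[2]} := 'X_0 in let y : {mpoly K[2]} := 'X_1 in
  iter m (horner (cubic_nf x y)) (- x) + x.

Definition pt2 (K : fieldType) (x y : K) : 'I_2 -> K :=
  tnth [tuple x; y].

Definition jacobian2 (K : fieldType) (F G : {mpoly K[2]}) (p : 'I_2 -> K) :
  'M[K]_2 :=
  \matrix_(i < 2, j < 2) ((if j == 0 then F else G)^`M(i)).@[p].

Definition transversal_at (K : fieldType) (F G : {mpoly K[2]}) (x y : K) :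
  Prop :=
  [/\ F.@[pt2 x y] = 0, G.@[pt2 x y] = 0 &
      \det (jacobian2 F G (pt2 x y)) != 0].

(* A point of the moduli space may have two pairs of coordinates, since (x, y)
   and (-x, -y) give conjugate triples; transversality is required in all of
   them, and there must be at least one. *)
Definition C1_C2_transversal_at (K : numFieldType) (n m : nat)
    (P : P3crit K) : Prop :=
  (exists x y : K, P3crit_class P (marked_nf x y)) /\
  (forall x y : K, P3crit_class P (marked_nf x y) ->
     transversal_at (Fpoly K n) (Gpoly K m) x y).

(* Main.v *)
Require Import Defs.
From HB Require Import structures.
From mathcomp Require Import all_boot all_order all_algebra.
From mathcomp Require Import boolp classical_sets reals.
From mathcomp Require Import mpoly.
From mathcomp Require Import ring zify.

(** The idea is to reduce modulo 3, where f(z) = z^3 - 3x^2 z + y becomes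
z^3 + y and every differential of an iterate forgets its past: modulo 3 the
partial derivatives of f^n(x) and of f^m(-x), for n, m >= 1, are 0 in x and 1
in y.  Hence modulo 3 the gradients of F^(n) and G^(m) are (-1, 1) and (1, 1),
and the Jacobian determinant is -2 = 1 (jacobian_neq0).

For this to say anything about the complex number obtained at an intersection
point (x, y), the coordinates must be integral at 3.  They are integral over
Z[1/2] (periodic_parameters_integral), and 3 is not invertible in the integral
closure O of Z[1/2] (third_notin), so a vanishing determinant would put
2/3, hence 1/3, in O.

Why x and y are integral.  In terms of a valuation with |2| = 1: if
r := max(|x|, |y|^(1/3)) > 1, then all periodic points satisfy |z| <= r, since
|z| > r implies |f(z)| = |z|^3 > |z|.  Then f(-x) - f(x) = 4x^3 and
f(x) + f(-x) = 2y have absolute value at most r, so r^3 <= r, a contradiction.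
The proof below replaces the valuation by integrality over Z[1/2][1/x], with the
scaling factor l = 1/x: dividing F^(n)(x, y) = 0 by a power of x gives a monic
equation for y / x^3 (iter_monic), so l z is integral for the points z of the
two critical orbits (iter_preimage_integral), then so is
4x^2 = l f(-x) - l f(x), and so is x = (1/4) (1/x) (4x^2).  Being integral over
Z[1/2][1/x], x is integral over Z[1/2] (int_closure_adjoin_inverse).  Finally y
is a root of F^(n)(x, .), which is monic over Z[x]; this is the case l = 1 of
the same lemma.

It remains to see that every class contains some (f_{x,y}, x, -x)
(affine_conj_nf) and that periodicity of the marked points passes to it
(affine_conj_iter). *)

Set Implicit Arguments.
Unset Strict Implicit.
Unset Printing Implicit Defensive.

Import Order.TTheory GRing.Theory Num.Theory.
Local Open Scope ring_scope.

(** * Integral closures *)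

(** A boolean predicate, so that closure under the ring operations is available
through the generic lemmas on subrings. *)
Definition int_closure (R K : nzRingType) (phi : R -> K) : {pred K} :=
  fun z => `[< integralOver phi z >].

Section IntegralClosure.
Variables (R : comNzRingType) (K : fieldType) (phi : {rmorphism R -> K}).

Lemma int_closureP z : reflect (integralOver phi z) (z \in int_closure phi).
Proof. exact: asboolP. Qed.

Lemma int_closure_subring : subring_closed (int_closure phi).
Proof.
split; first exact/int_closureP/integral1.
  by move=> u v /int_closureP ? /int_closureP ?; apply/int_closureP/integral_sub.
by move=> u v /int_closureP ? /int_closureP ?; apply/int_closureP/integral_mul.
Qed.

HB.instance Definition _ :=
  GRing.isSubringClosed.Build K (int_closure phi) int_closure_subring.

Lemma int_closure_id a : phi a \in int_closure phi.
Proof. exact/int_closureP/integral_id. Qed.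

Lemma int_closure_root (p : {poly K}) z :
  p \is monic -> p \is a polyOver (int_closure phi) -> root p z ->
  z \in int_closure phi.
Proof.
move=> p_monic /polyOverP pO pz; apply/int_closureP.
apply: integral_root_monic p_monic pz _.
by apply/integral_poly => i; apply/int_closureP.
Qed.

(** An element b of R whose inverse is integral becomes a unit modulo the kernel
of phi: multiply an equation of degree d for the inverse z by b^d. *)
Lemma int_closure_inv b z :
  z \in int_closure phi -> phi b * z = 1 -> exists c, phi (1 + b * c) = 0.
Proof.
move=> /int_closureP[p p_monic pz] bz; set d := (size p).-1.
have size_p : size p = d.+1 by rewrite prednK // size_poly_gt0 monic_neq0.
exists (\sum_(i < d) b ^+ (d - i).-1 * p`_i).
have bzi i : (i <= d)%N -> phi b ^+ d * z ^+ i = phi b ^+ (d - i).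
  move=> le_id; rewrite -[in LHS](subnK le_id) exprD -mulrA -exprMn bz.
  by rewrite expr1n mulr1.
have := congr1 ( *%R (phi b ^+ d)) (rootP pz); rewrite mulr0 => <-.
rewrite horner_poly size_p big_ord_recr rmorphD rmorph1 [in LHS]addrC mulrDr.
congr (_ + _).
  rewrite mulr_sumr rmorph_sum mulr_sumr /=; apply: eq_bigr => i _.
  rewrite [RHS]mulrCA bzi 1?ltnW // mulrA -exprS prednK ?subn_gt0 //.
  by rewrite rmorphM rmorphXn mulrC.
rewrite mulrCA bzi // subnn mulr1 -[d]/((size p).-1) -lead_coefE.
by rewrite (monicP p_monic) rmorph1.
Qed.

End IntegralClosure.

Section Adjoin.
Variables (R : comNzRingType) (K : fieldType) (phi : {rmorphism R -> K}) (u : K).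

(** The ring R[u], as the image of R[X] in K, so that integrality over R[u] can be
stated; Z[1/2] is the case of intr and 2^-1. *)
Definition adjoin (p : {poly R}) : K := (map_poly phi p).[u].

Lemma adjoin_is_zmod_morphism : zmod_morphism adjoin.
Proof. by move=> p q; rewrite /adjoin rmorphB !hornerE. Qed.

Lemma adjoin_is_monoid_morphism : monoid_morphism adjoin.
Proof. by split=> [|p q]; rewrite /adjoin ?rmorph1 ?rmorphM !hornerE. Qed.

HB.instance Definition _ :=
  GRing.isZmodMorphism.Build {poly R} K adjoin adjoin_is_zmod_morphism.
HB.instance Definition _ :=
  GRing.isMonoidMorphism.Build {poly R} K adjoin adjoin_is_monoid_morphism.

Lemma adjoinC a : adjoin a%:P = phi a.
Proof. by rewrite /adjoin map_polyC hornerC. Qed.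

Lemma adjoinX : adjoin 'X = u.
Proof. by rewrite /adjoin map_polyX hornerX. Qed.
End Adjoin.

Section AdjoinInverse.
Variables (R : comNzRingType) (K : fieldType) (phi : {rmorphism R -> K}).

Lemma adjoin_sub u z : z \in int_closure phi -> z \in int_closure (adjoin phi u).
Proof.
move=> /int_closureP[p p_monic pz].
apply: (@int_closure_root _ _ _ (map_poly phi p)) => //; first exact: monic_map.
apply/polyOverP => i; rewrite coef_map /= -(adjoinC phi u).
exact: (int_closure_id (adjoin phi u)).
Qed.

(** Clearing denominators in a polynomial in 1/u reverses its coefficients. *)
Lemma adjoin_inverseE u (p : {poly R}) : u != 0 ->
  u ^+ size p * adjoin phi u^-1 p =
  u * (map_poly phi (\poly_(i < size p) p`_(size p - i.+1))).[u].
Proof.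
move=> u0; rewrite /adjoin.
rewrite (horner_coef_wide _ (size_poly _ _)).
rewrite [in RHS](@horner_coef_wide _ (size p)); last first.
  exact: leq_trans (size_poly _ _) (size_poly _ _).
rewrite (reindex_inj rev_ord_inj) !mulr_sumr; apply: eq_bigr => i _ /=.
rewrite !coef_map /= coef_poly ltn_ord mulrCA [RHS]mulrCA; congr (_ * _).
rewrite -exprS exprVn; apply: (canLR (mulfK _)); first by rewrite expf_neq0.
by rewrite -exprD subnKC.
Qed.

(** Over R[1/x] the element 1/x has the integral inverse x, so some
1 + (1/x) c(1/x) vanishes; clearing denominators gives a monic equation for x
over R. *)
Lemma int_closure_adjoin_inverse x :
  x != 0 -> x \in int_closure (adjoin phi x^-1) -> x \in int_closure phi.
Proof.
move=> x0 xO.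
have [|c c0] := int_closure_inv xO (b := 'X); first by rewrite /= adjoinX mulVf.
pose q := \poly_(i < size c) c`_(size c - i.+1).
apply: (@int_closure_root _ _ _ (map_poly phi ('X^(size c) + q))).
- rewrite monic_map // monicE lead_coefDl ?lead_coefXn //.
  by rewrite size_polyXn ltnS size_poly.
- by apply/polyOverP => i; rewrite coef_map int_closure_id.
apply/rootP; rewrite rmorphD /= map_polyXn !hornerE.
apply: (mulfI x0); rewrite mulr0 mulrDr -adjoin_inverseE //.
have := c0; rewrite rmorphD rmorph1 rmorphM /= adjoinX.
by move/(congr1 ( *%R (x * x ^+ size c))); rewrite mulr0 => <-; field.
Qed.

End AdjoinInverse.

(** Otherwise 1 + 3 c(1/2) = 0 for an integer polynomial c, and clearing
denominators makes 3 divide a power of 2. *)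
Lemma third_notin (K : numFieldType) :
  (3 : K)^-1 \notin int_closure (adjoin (intr : int -> K) 2^-1).
Proof.
apply/negP => h; have [|c] := int_closure_inv h (b := 3).
  by rewrite rmorph_nat mulfV // pnatr_eq0.
rewrite rmorphD rmorph1 rmorphM rmorph_nat => /(congr1 ( *%R (2 ^+ size c))).
rewrite mulr0 mulrDr mulr1 mulrCA adjoin_inverseE ?pnatr_eq0 //.
set q := \poly_(i < _) _; have -> : (2 : K) = intr (2 : int) by [].
rewrite horner_map -(rmorphXn intr) -[3]/(intr (3 : int)).
rewrite -!(rmorphM intr) -(rmorphD intr) => /eqP.
rewrite intr_eq0 addr_eq0 => /eqP two_pow.
have : (3 %| (2 : int)%R ^+ size c)%Z by rewrite two_pow rpredN dvdz_mulr.
by rewrite dvdzE abszX Euclid_dvdX.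
Qed.

(** * Integrality of the parameters *)

Lemma horner_cubic_nf (A : comNzRingType) (x y z : A) :
  (cubic_nf x y).[z] = z ^+ 3 - 3 * x ^+ 2 * z + y.
Proof. by rewrite /cubic_nf !hornerE. Qed.

Section Dynamics.
Variables (R : comNzRingType) (K : fieldType) (phi : {rmorphism R -> K}).
Variables (x y l : K).
Local Notation O := (int_closure phi).
Local Notation f := (horner (cubic_nf x y)).
Hypotheses (lO : l \in O) (lxO : l * x \in O).

(** When x has weight 1 and y has weight 3, the polynomial f^(n+1)(x) has weight
3^(n+1), with top part (y - 2 x^3)^(3^n).  Hence after multiplication by
l^(3^(n+1)), written l L here, it is a polynomial over Z[l, l x] that is monic
in l^3 y. *)
Lemma iter_monic n : exists (L : K) (Q : {poly K}),
  [/\ L \in O, Q \is monic, (1 < size Q)%N, Q \is a polyOver O &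
      Q.[l ^+ 3 * y] = l * L * iter n.+1 f x].
Proof.
elim: n => [|n [L [Q [LO Q_monic Q_size QO Qy]]]].
  (* f x = y - 2 x^3 *)
  exists (l ^+ 2), ('X - (2 * (l * x) ^+ 3)%:P); split.
  - exact: rpredX.
  - exact: monicXsubC.
  - by rewrite size_XsubC.
  - by rewrite polyOverXsubC rpredM ?rpredX ?rpred_nat.
  - by rewrite /= horner_cubic_nf hornerXsubC; ring.
pose a := 3 * (l * x) ^+ 2 * L ^+ 2; pose b := L ^+ 3.
have aO : a \in O.
  by rewrite rpredM ?[_ \in _]rpredX // rpredM ?rpredX ?rpred_nat.
have bO : b \in O by rewrite rpredX.
have Q3_size : size (Q ^+ 3) = (3 * (size Q).-1).+1.
  rewrite -[LHS]prednK ?size_exp 1?mulnC //.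
  by rewrite size_poly_gt0 expf_neq0 ?monic_neq0.
have low_size : (size (b *: 'X - a *: Q)%R < size (Q ^+ 3))%N.
  apply: leq_ltn_trans (size_polyD _ _) _; rewrite gtn_max size_polyN.
  rewrite !(leq_ltn_trans (size_scale_leq _ _)) ?size_polyX ?Q3_size //.
    by case: (size Q) Q_size => [|[|s]] // _; lia.
  by case: (size Q) Q_size => [|[|s]] // _; rewrite ltnS mulnS.
exists (l ^+ 2 * L ^+ 3), (Q ^+ 3 + (b *: 'X - a *: Q)); split.
- by rewrite rpredM ?rpredX.
- by rewrite monicE lead_coefDl // -monicE monic_exp.
- by rewrite size_polyDl // Q3_size; case: (size Q) Q_size => [|[|s]].
- by rewrite rpredD ?rpredX // rpredB ?polyOverZ ?polyOverX.
rewrite iterS horner_cubic_nf.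
by rewrite !(hornerD, hornerN, hornerZ, horner_exp, hornerX) Qy /a /b; ring.
Qed.

Lemma periodic_param_integral n : iter n.+1 f x = x -> l ^+ 3 * y \in O.
Proof.
move=> fx; have [L [Q [LO Q_monic Q_size QO]]] := iter_monic n.
rewrite fx => Qy; set c := l * L * x in Qy.
have cO : c \in O by rewrite /c mulrAC rpredM.
have c_size : (size (- c%:P) < size Q)%N.
  by rewrite size_polyN (leq_ltn_trans (size_polyC_leq1 _)).
apply: (@int_closure_root _ _ _ (Q - c%:P)).
- by rewrite monicE lead_coefDl.
- by rewrite rpredB ?polyOverC.
- by rewrite rootE !hornerE Qy subrr.
Qed.

Hypothesis lyO : l ^+ 3 * y \in O.

(** The equation satisfied by z over its image, scaled by l^3, is monic in
l z. *)
Lemma preimage_integral z : l * f z \in O -> l * z \in O.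
Proof.
move=> lfO.
(* The equation z^3 - 3 x^2 z + y - f z = 0 times l^3, in the unknown l z. *)
pose q := - (3 * (l * x) ^+ 2) *: 'X + (l ^+ 3 * y - l ^+ 2 * (l * f z))%:P.
have q_size : (size q < size ('X^3 : {poly K}))%N.
  rewrite size_polyXn (leq_ltn_trans (size_polyD _ _)) // gtn_max.
  rewrite (leq_ltn_trans (size_scale_leq _ _)) ?size_polyX //.
  by rewrite (leq_ltn_trans (size_polyC_leq1 _)).
apply: (@int_closure_root _ _ _ ('X^3 + q)).
- by rewrite monicE lead_coefDl ?lead_coefXn.
- rewrite rpredD ?polyOverXn // rpredD ?polyOverZ ?polyOverX ?polyOverC //.
    by rewrite rpredN rpredM ?rpredX ?rpred_nat.
  by rewrite rpredB // rpredM // rpredX.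
- rewrite rootE /q horner_cubic_nf.
  by rewrite !(hornerD, hornerZ, hornerC, hornerX, hornerXn); apply/eqP; ring.
Qed.

Lemma iter_preimage_integral n z : l * iter n f z \in O -> l * z \in O.
Proof. by elim: n => // n IHn /preimage_integral. Qed.

End Dynamics.

(** The factor l = 1/x makes l x = 1 integral for free and yields the integrality
of x; once this is known, l = 1 is allowed and yields that of y. *)
Lemma periodic_parameters_integral (R : comNzRingType) (K : fieldType)
    (phi : {rmorphism R -> K}) (x y : K) n m :
  2 != 0 :> K -> 2^-1 \in int_closure phi ->
  iter n.+1 (horner (cubic_nf x y)) x = x ->
  iter m.+1 (horner (cubic_nf x y)) (- x) = - x ->
  x \in int_closure phi /\ y \in int_closure phi.
Proof.
move=> two0 halfO fx fNx.
have xO : x \in int_closure phi.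
  have [->|x0] := eqVneq x 0; first exact: rpred0.
  apply: int_closure_adjoin_inverse => //.
  set psi := adjoin phi x^-1.
  have lO : x^-1 \in int_closure psi.
    by rewrite -(adjoinX phi x^-1) (int_closure_id psi).
  have lxO : x^-1 * x \in int_closure psi by rewrite mulVf // rpred1.
  have lyO := periodic_param_integral lO lxO fx.
  have first_image z k : x^-1 * z \in int_closure psi ->
      iter k.+1 (horner (cubic_nf x y)) z = z ->
      x^-1 * (cubic_nf x y).[z] \in int_closure psi.
    rewrite iterSr => zO fz.
    by apply: (iter_preimage_integral lO lxO lyO (n := k)); rewrite fz.
  have z1O := first_image _ _ lxO fx.
  have w1O : x^-1 * (cubic_nf x y).[- x] \in int_closure psi.
    by apply: first_image fNx; rewrite mulrN rpredN.
  (* f (- x) - f x = 4 x^3 *)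
  have -> : x = 2^-1 ^+ 2 * x^-1 *
      (x^-1 * (cubic_nf x y).[- x] - x^-1 * (cubic_nf x y).[x]).
    by rewrite !horner_cubic_nf; field; rewrite x0.
  rewrite rpredM ?rpredB // rpredM // rpredX //.
  exact: adjoin_sub.
split=> //; rewrite -[y]mul1r -(expr1n _ 3).
by apply: periodic_param_integral fx; rewrite ?mul1r ?rpred1.
Qed.

(** * Reduction of the Jacobian modulo 3 *)

Section Transversality.
Variable K : numFieldType.
Variables x y : K.
Local Notation O := (int_closure (adjoin (intr : int -> K) 2^-1)).
Local Notation X := ('X_0 : {mpoly K[2]}).
Local Notation Y := ('X_1 : {mpoly K[2]}).
Local Notation orbit k c := (iter k (horner (cubic_nf X Y)) c).
Local Notation p := (pt2 x y).

Lemma meval_orbit k (c : {mpoly K[2]}) :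
  (orbit k c).@[p] = iter k (horner (cubic_nf x y)) c.@[p].
Proof.
elim: k => //= k IHk; rewrite !horner_cubic_nf -IHk.
by rewrite mevalD mevalB !mevalM !mevalXU (rmorph_nat (meval p)).
Qed.

Lemma meval_mderiv_var (i j : 'I_2) :
  (('X_j : {mpoly K[2]})^`M(i)).@[p] = (i == j)%:R.
Proof.
rewrite mderivX mevalZ mnm1E eq_sym; case: eqVneq => [->|_]; last by rewrite mul0r.
rewrite (_ : (U_(j) - U_(j))%MM = 0%MM) ?mpolyX0 ?meval1 ?mulr1 //.
by apply/mnmP => k; rewrite mnmBE mnm0E subnn.
Qed.

(** The chain rule; the point is that all terms are divisible by 3, except for
the derivative of the additive parameter y. *)
Lemma mderiv_orbitS k c (i : 'I_2) :
  ((orbit k.+1 c)^`M(i)).@[p] =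
  3 * (((orbit k c).@[p] ^+ 2 - x ^+ 2) * ((orbit k c)^`M(i)).@[p]
        - 2 * x * (i == 0)%:R * (orbit k c).@[p]) + (i == 1)%:R.
Proof.
rewrite iterS horner_cubic_nf; set z := orbit k c.
have -> : (3 : {mpoly K[2]}) = 3%:MP by rewrite [RHS]rmorph_nat.
rewrite mderivD mderivB -mulrA mderiv_mulC !exprS !expr0 !mulr1 !mderivM.
rewrite !(mevalD, mevalN, mevalM, mevalC, meval_mderiv_var, mevalXU).
have -> : p 0 = x by [].
ring.
Qed.

Hypotheses (xO : x \in O) (yO : y \in O).

Lemma orbit_integral k c : c.@[p] \in O -> (orbit k c).@[p] \in O.
Proof.
move=> cO; rewrite meval_orbit; elim: k => //= k IHk; rewrite horner_cubic_nf.
by rewrite rpredD // rpredB ?rpredX // rpredM // rpredM ?rpredX ?rpred_nat.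
Qed.

Lemma mderiv_orbit_integral k c (i : 'I_2) :
  c.@[p] \in O -> (c^`M(i)).@[p] \in O -> ((orbit k c)^`M(i)).@[p] \in O.
Proof.
move=> cO dcO; elim: k => // k IHk; rewrite mderiv_orbitS.
have zO := orbit_integral k cO.
rewrite rpredD ?rpred_nat // rpredM ?rpred_nat // rpredB //.
  by rewrite rpredM // rpredB ?rpredX.
by rewrite rpredM // rpredM ?rpred_nat // rpredM ?rpred_nat.
Qed.

Lemma mderiv_orbit_mod3 k c (i : 'I_2) :
  c.@[p] \in O -> (c^`M(i)).@[p] \in O ->
  exists2 r, r \in O & ((orbit k.+1 c)^`M(i)).@[p] = 3 * r + (i == 1)%:R.
Proof.
move=> cO dcO; eexists; last exact: mderiv_orbitS.
have zO := orbit_integral k cO; have dzO := mderiv_orbit_integral k cO dcO.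
rewrite rpredB //; first by rewrite rpredM // rpredB ?rpredX.
by rewrite rpredM // rpredM ?rpred_nat // rpredM ?rpred_nat.
Qed.

(** Expanding the determinant with derivatives known modulo 3 gives
-2 + 3 r with r in O; if it vanishes, then 1/3 = 1 - r. *)
Lemma jacobian_neq0 n m :
  \det (jacobian2 (Fpoly K n.+1) (Gpoly K m.+1) p) != 0.
Proof.
have X_O : X.@[p] \in O by rewrite mevalXU.
have NX_O : (- X).@[p] \in O by rewrite mevalN rpredN.
have dXE (i : 'I_2) : (X^`M(i)).@[p] = (i == 0)%:R.
  exact: meval_mderiv_var.
have dX_O i : (X^`M(i)).@[p] \in O by rewrite dXE rpred_nat.
have dNX_O i : ((- X)^`M(i)).@[p] \in O by rewrite mderivN mevalN rpredN.
have [Fx FxO FxE] := mderiv_orbit_mod3 n X_O (dX_O 0).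
have [Fy FyO FyE] := mderiv_orbit_mod3 n X_O (dX_O 1).
have [Gx GxO GxE] := mderiv_orbit_mod3 m NX_O (dNX_O 0).
have [Gy GyO GyE] := mderiv_orbit_mod3 m NX_O (dNX_O 1).
have det_mod3 : \det (jacobian2 (Fpoly K n.+1) (Gpoly K m.+1) p) =
    (3 * Fx - 1) * (3 * Gy + 1) - (3 * Gx + 1) * (3 * Fy + 1).
  rewrite (expand_det_row _ 0) !big_ord_recl big_ord0 /cofactor !det_mx11.
  rewrite !mxE /= /Fpoly /Gpoly.
  rewrite !(mderivD, mderivN, mevalD, mevalN) !dXE.
  rewrite (_ : lift 0 0 = 1); last exact: val_inj.
  by rewrite FxE FyE GxE GyE /= /bump /=; ring.
apply/eqP => det0; have /negP := third_notin K; apply.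
have -> : 3^-1 = 1 - (Fx - Fy - Gx - Gy + 3 * (Fx * Gy - Gx * Fy)) :> K.
  have : 3 != 0 :> K by rewrite pnatr_eq0.
  move: det0; rewrite det_mod3 => det0 three0; apply: (mulfI three0).
  by rewrite mulfV // -[RHS]addr0 -det0; ring.
rewrite rpredB ?rpred1 // rpredD ?rpredB // rpredM ?rpred_nat //.
by rewrite rpredB // rpredM.
Qed.

Lemma nf_transversal n m :
  iter n.+1 (horner (cubic_nf x y)) x = x ->
  iter m.+1 (horner (cubic_nf x y)) (- x) = - x ->
  transversal_at (Fpoly K n.+1) (Gpoly K m.+1) x y.
Proof.
move=> fx fNx; split; last exact: jacobian_neq0.
  by rewrite /Fpoly mevalB meval_orbit mevalXU fx subrr.
by rewrite /Gpoly mevalD meval_orbit mevalN mevalXU fNx addNr.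
Qed.
End Transversality.

(** * Normal forms in the moduli space *)

Section NormalForm.
Variable K : numClosedFieldType.

Lemma iter_semiconj (f g A : K -> K) n z : (forall z, g (A z) = A (f z)) ->
  iter n g (A z) = A (iter n f z).
Proof. by move=> gA; elim: n => //= n ->. Qed.

Lemma affine_conj_iter (t u : marked_cubic K) n :
  affine_conj t u ->
  (iter n (horner (mc_poly t)) (mc_c1 t) = mc_c1 t <->
   iter n (horner (mc_poly u)) (mc_c1 u) = mc_c1 u) /\
  (iter n (horner (mc_poly t)) (mc_c2 t) = mc_c2 t <->
   iter n (horner (mc_poly u)) (mc_c2 u) = mc_c2 u).
Proof.
case=> a [b [a0 [/= conj -> ->]]].
have A_inj : injective (horner (a *: 'X + b%:P)).
  by move=> v w; rewrite !hornerE => /addIr/(mulfI a0).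
have AE v : (mc_poly u).[(a *: 'X + b%:P).[v]] = (a *: 'X + b%:P).[(mc_poly t).[v]].
  by rewrite -!horner_comp conj.
by split; rewrite (iter_semiconj _ _ AE); split=> [->|/A_inj].
Qed.

Lemma deriv0_const (p : {poly K}) : p^`() = 0 -> p = (p.[0])%:P.
Proof.
move=> dp; apply/polyP => -[|i]; rewrite coefC horner_coef0 //=.
have /eqP := congr1 (fun q : {poly K} => q`_i) dp.
by rewrite coef_deriv coef0 mulrn_eq0 => /eqP.
Qed.

(** Conjugation by z -> a z + b divides the leading coefficient by a^2, so a
is a square root of it; b moves the midpoint of the critical points to 0, and y
adjusts the constant term.  The two sides of the conjugacy equation then have
the same derivative and the same value at 0. *)
Lemma affine_conj_nf (t : marked_cubic K) :
  exists x y : K, affine_conj t (marked_nf x y).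
Proof.
case: t => f c1 c2 f_size f_crit; have /eqpP[[u v] /= /andP[u0 v0] crit] := f_crit.
(* The leading coefficient of f, since f' = (v / u) (X - c1) (X - c2). *)
pose lc := v / u / 3.
pose a := sqrtC lc; pose b := - (a * (c1 + c2) / 2); pose x := a * c1 + b.
pose A := a *: 'X + b%:P.
have three0 : 3 != 0 :> K by rewrite pnatr_eq0.
have a0 : a != 0 by rewrite sqrtC_eq0 !mulf_neq0 ?invr_eq0.
have f' : f^`() = (3 * a ^+ 2)%:P * (('X - c1%:P) * ('X - c2%:P)).
  rewrite mul_polyC sqrtCK (_ : 3 * lc = v / u); last by rewrite mulrC divfK.
  by rewrite mulrC -scalerA -crit scalerA mulVf // scale1r.
have Ac1 : A - x%:P = a%:P * ('X - c1%:P).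
  by rewrite /A /x -mul_polyC !polyCD polyCM; ring.
have Ac2 : A + x%:P = a%:P * ('X - c2%:P).
  have -> : x = - (a * c2 + b) by rewrite /x /b; field.
  by rewrite /A -mul_polyC (polyCN (a * c2 + b)) (polyCD (a * c2)) polyCM; ring.
exists x, (A.[f.[0]] - A.[0] ^+ 3 + 3 * x ^+ 2 * A.[0]), a, b; split=> //=.
split; first last.
- by rewrite !hornerE /x /b; field.
- by rewrite !hornerE.
rewrite -/A; apply: subr0_eq; set D := _ - _.
have dD : D^`() = 0.
  have A' : A^`() = a%:P by rewrite /A derivD derivZ derivX derivC addr0 alg_polyC.
  rewrite /D derivB !deriv_comp A' comp_polyC f'.
  rewrite /cubic_nf derivD derivB derivXn derivZ derivX derivC addr0.
  rewrite comp_polyB comp_polyZ raddfMn /= comp_Xn_poly (comp_polyC 1) -mul_polyC.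
  have -> : (3 * x ^+ 2)%:P * 1%:P = 3 * x%:P ^+ 2.
    by rewrite mulr1 polyCM polyC_exp (rmorph_nat polyC).
  have -> : (3 * a ^+ 2)%:P = 3 * a%:P ^+ 2.
    by rewrite polyCM polyC_exp (rmorph_nat polyC).
  transitivity (3 * a%:P * ((A - x%:P) * (A + x%:P)) -
                a%:P * (3 * a%:P ^+ 2 * (('X - c1%:P) * ('X - c2%:P)))).
    by ring.
  by rewrite Ac1 Ac2; ring.
suff D0 : D.[0] = 0 by rewrite (deriv0_const dD) D0.
by rewrite hornerD hornerN !horner_comp horner_cubic_nf; ring.
Qed.
End NormalForm.

Theorem theorem1 (R : realType) (n m : nat) (hn : (1 <= n)%N) (hm : (1 <= m)%N)
    (P : P3crit R[i]) (hP1 : C1 n P) (hP2 : C2 m P) :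
  C1_C2_transversal_at n m P.
Proof.
have [t Pt] := P3crit_classP P.
case: n hn hP1 => // n _ [t1]; case: m hm hP2 => // m _ [t2].
rewrite Pt => tt2 t2_per tt1 t1_per.
have t_per1 := (affine_conj_iter n.+1 tt1).1.2 t1_per.
have t_per2 := (affine_conj_iter m.+1 tt2).2.2 t2_per.
split; first by have [x [y txy]] := affine_conj_nf t; exists x, y; rewrite Pt.
move=> x y; rewrite Pt => txy.
have x_per := (affine_conj_iter n.+1 txy).1.1 t_per1.
have Nx_per := (affine_conj_iter m.+1 txy).2.1 t_per2.
have two0 : 2 != 0 :> R[i] by rewrite pnatr_eq0.
have [|xO yO] := periodic_parameters_integral
  (phi := adjoin intr 2^-1) two0 _ x_per Nx_per.
  by rewrite -[X in X \in _](adjoinX intr) (int_closure_id (adjoin intr _)).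
exact: nf_transversal.
Qed.
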